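(* Fix an unshifted or a shifted skew shape $\mu/\lambda$ and let $n = |\mu/\lambda|$ be its number of cells. Let $P, Q$ be two standard skew tableaux (shifted standard skew tableaux in the shifted case) of shape $\mu/\lambda$, and let $\pi$ be a permutation of $\{1,2,\dots,n\}$. Then $$\operatorname{MJ}_P(P_\pi) = Q \iff \operatorname{MJ}_Q(Q_{\pi^{-1}}) = P,$$ where $\operatorname{MJ}_S(T)$ denotes the result of modified jeu de taquin in the tabloid $T$ with respect to $S$, and $S_\pi$ denotes the tabloid obtained from $S$ by replacing every entry $i$ by $\pi(i)$.
   Context: **Shapes.** A partition is a sequence of integers $\lambda = (\lambda_1,\dots,\lambda_r)$ with $\lambda_1 \ge \dots \ge \lambda_r \ge 0$ (trailing zeros are allowed, so that two partitions can be written with the same number $r$ of components). Cells are pairs $(i,j)$ = (row, column), with rows numbered from top to bottom and columns from left to right. The unshifted Ferrers diagram of $\lambda$ consists of the cells $(i,j)$ with $1\le i\le r$, $1 \le j \le \lambda_i$. If the nonzero components of $\lambda$ are distinct, the shifted Ferrers diagram of $\lambda$ consists of the cells $(i,j)$ with $1\le i\le r$, $i \le j \le i+\lambda_i-1$ (each row is indented by one cell to the right with respect to the previous row). If $\mu=(\mu_1,\dots,\mu_r)$ and $\lambda=(\lambda_1,\dots,\lambda_r)$ are partitions (in the shifted case, partitions with distinct nonzero components) with $\lambda_i \le \mu_i$ for all $1\le i \le r$, the unshifted (resp. shifted) skew Ferrers diagram of shape $\mu/\lambda$ is obtained by removing the cells of the unshifted (resp. shifted) Ferrers diagram of $\lambda$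 from that of $\mu$. Its number of cells is $n = |\mu/\lambda|$. **Tabloids and tableaux.** A tabloid of (shifted) skew shape $\mu/\lambda$ is an arbitrary filling of the cells of the (shifted) skew Ferrers diagram of $\mu/\lambda$ with $1,2,\dots,n$, each used exactly once. A (shifted) standard skew tableau is a tabloid whose entries increase along rows (left to right) and down columns (top to bottom). **Forward jeu de taquin.** Let $T$ be a tabloid and $e$ an entry of $T$. Forward jeu de taquin in $T$ with $e$ is the following procedure, where cells outside the shape are regarded as having entry $\infty$. Consider the entry to the right of $e$ and the entry below $e$; if $e$ is greater than the minimum of these two, exchange $e$ with that minimum. Repeat with $e$ in its new position until $e$ is smaller than both its right neighbour and its neighbour below. **Modified jeu de taquin.** Let $T$ be a tabloid and $S$ a (shifted) standard skew tableau of the same shape. For $1 \le k\le n$ let $e_k$ be the entry of $T$ in the cell which has label (entry) $k$ in $S$. Starting with $T$, perform successively forward jeu de taquin with $e_n$, then (in the resulting tabloid) with $e_{n-1}$, and so on, down to $e_1$. The final result, which is a (shifted) standard skew tableau, is denoted $\operatorname{MJ}_S(T)$. **Relabelling.** For a (shifted) standard skew tableau $S$ and a permutation $\pi$ of $\{1,\dots,n\}$, $S_\pi$ is the tabloid obtained from $S$ by replacing every entry $i$ by $\pi(i)$. *)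

(* Defs.v *)
From mathcomp Require Import all_boot all_fingroup zify.

Set Implicit Arguments.
Unset Strict Implicit.
Unset Printing Implicit Defensive.

(* Rows, columns and entries are all numbered from 0: the entry i of a filling
   with 1, ..., n is represented by the element i - 1 of 'I_n. *)

Definition is_partition (shifted : bool) (la : seq nat) : bool :=
  sorted geq la && (shifted ==> uniq [seq x <- la | x != 0]).

Definition diagram (shifted : bool) (la : seq nat) : seq (nat * nat) :=
  [seq (i, j) | i <- iota 0 (size la),
                j <- iota (if shifted then i else 0) (nth 0 la i)].

Definition is_skew_shape (shifted : bool) (r : nat) (la mu : r.-tuple nat) :
    bool :=
  [&& is_partition shifted la, is_partition shifted mu
    & [forall i, tnth la i <= tnth mu i]].

Definition skew_diagram (shifted : bool) (r : nat) (la mu : r.-tuple nat) :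
    seq (nat * nat) :=
  [seq c <- diagram shifted mu | c \notin diagram shifted la].

(* In what follows D lists the cells of a diagram. *)

Definition cell (D : seq (nat * nat)) : finType := seq_sub D.

Definition filling (D : seq (nat * nat)) : finType :=
  {ffun cell D -> 'I_#|cell D|}.

Definition is_tabloid (D : seq (nat * nat)) (T : filling D) : bool :=
  injectiveb T.

Definition is_standard (D : seq (nat * nat)) (T : filling D) : Prop :=
  [/\ is_tabloid T,
      forall c d : cell D,
        (val c).1 = (val d).1 -> (val c).2 < (val d).2 -> T c < T d
    & forall c d : cell D,
        (val c).2 = (val d).2 -> (val c).1 < (val d).1 -> T c < T d].

Definition locate (D : seq (nat * nat)) (T : filling D) (e : 'I_#|cell D|) :
    option (cell D) :=
  [pick c | T c == e].

(* Entries inside D are smaller than #|cell D|, which thus plays the role of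
   the entry oo of the positions outside D. *)
Definition entry (D : seq (nat * nat)) (T : filling D) (p : nat * nat) : nat :=
  if insub p is Some c then T c else #|cell D|.

Definition exchange (D : seq (nat * nat)) (T : filling D) (c d : cell D) :
    filling D :=
  [ffun x => T (tperm c d x)].

Definition jdt_step (D : seq (nat * nat)) (e : 'I_#|cell D|) (T : filling D) :
    filling D :=
  if locate T e is Some c then
    let right := ((val c).1, (val c).2.+1) in
    let below := ((val c).1.+1, (val c).2) in
    let p := if entry T right < entry T below then right else below in
    if entry T p < e then
      if insub p is Some d then exchange T c d else T
    else T
  else T.

(* Each exchange moves e one step right or down, so that e visits no cell
   twice and #|cell D| steps exhaust the procedure (see jdt_stops). *)
Definition jdt (D : seq (nat * nat)) (e : 'I_#|cell D|) (T : filling D) :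
    filling D :=
  iter #|cell D| (jdt_step e) T.

(* The fold starts from T and treats the labels k in decreasing order; the
   entry e_k = T c is read off the initial tabloid T. *)
Definition MJ (D : seq (nat * nat)) (S T : filling D) : filling D :=
  foldr (fun k U => if locate S k is Some c then jdt (T c) U else U)
        T (enum 'I_#|cell D|).

Definition relabel (D : seq (nat * nat)) (S : filling D)
    (pi : {perm 'I_#|cell D|}) : filling D :=
  [ffun c => pi (S c)].

Lemma jdt_step_tabloid (D : seq (nat * nat)) (e : 'I_#|cell D|)
    (T : filling D) :
  is_tabloid T -> is_tabloid (jdt_step e T).
Proof.
move=> Tinj; rewrite /jdt_step.
case: locate => [c|//] /=; case: ifP => // _; case: insubP => //= d _ _.
apply/injectiveP=> x y; rewrite !ffunE => /(injectiveP _ Tinj); exact: perm_inj.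
Qed.

Lemma jdt_stops (D : seq (nat * nat)) (e : 'I_#|cell D|) (T : filling D) :
  is_tabloid T -> jdt_step e (jdt e T) = jdt e T.
Proof.
pose ht (c : cell D) := (val c).1 + (val c).2.
pose m (U : filling D) :=
  if locate U e is Some c then #|[pred d | ht c < ht d]| else 0.
have step U : is_tabloid U -> jdt_step e U = U \/ m (jdt_step e U) < m U.
  move=> Uinj; rewrite {1 2}/jdt_step {2}/m.
  case Ec: (locate U e) => [c|]; last by left.
  move=> /=; set p := (X in entry U X < _); case: ifP => _; last by left.
  case: insubP => [d _ dE|_]; last by left.
  right; have Uc : U c = e.
    by move: Ec; rewrite /locate; case: pickP => // x /eqP Ux [<-].
  have hd : ht d = (ht c).+1 by rewrite /ht dE /p; case: ifP => _ /=; lia.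
  have -> : m (exchange U c d) = #|[pred x | ht d < ht x]|.
    rewrite /m /locate; case: pickP => [x|/(_ d)]; rewrite ffunE.
      rewrite -Uc => /eqP/(injectiveP _ Uinj) /(canRL (tpermK c d)).
      by rewrite tpermL => ->.
    by rewrite tpermR Uc eqxx.
  apply: proper_card; apply/properP; split.
    by apply/subsetP=> x; rewrite !inE hd => /ltnW.
  by exists d; rewrite !inE ?ltnn // hd.
move=> Tinj.
have inj k : is_tabloid (iter k (jdt_step e) T).
  by elim: k => //= k; exact: jdt_step_tabloid.
have bound k : jdt_step e (iter k (jdt_step e) T) = iter k (jdt_step e) T
            \/ m (iter k (jdt_step e) T) + k <= #|cell D|.
  elim: k => [|k [IH|IH]] /=.
  - by right; rewrite addn0 /m; case: locate => // c; exact: max_card.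
  - by left; rewrite !IH.
  case: (step _ (inj k)) => [fix_k|lt_m]; first by left; rewrite !fix_k.
  by right; rewrite addnS; apply: leq_trans IH; rewrite -addSn leq_add2r.
rewrite /jdt; case: (bound #|cell D|) => // le_m.
by case: (step _ (inj #|cell D|)) => // lt_m; lia.
Qed.

(* Main.v *)
Require Import Defs.
From mathcomp Require Import all_boot all_fingroup zify.

Set Implicit Arguments.
Unset Strict Implicit.
Unset Printing Implicit Defensive.

(** Let [U_k] be the tabloid obtained from [P_pi] after the slides with
    [e_n, ..., e_k], and let [G k j] be the set of cells which have label at
    least [k] in [P] and entry at least [j] in [U_k]. The four sets at the
    corners of a unit square of this array satisfy a local rule which is
    invariant under exchanging [k] with [j] and [pi] with its inverse, and by
    which the array is determined by its border [G k 0], given by [P].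
    The border [G 0 j] is given by the result [Q] of the algorithm, so that the
    transposed array is the one attached to [Q] and the inverse of [pi]. *)

Section Growth.

Variable D : seq (nat * nat).
Implicit Types (p c d x y z : cell D) (V W U S T P Q : filling D).
Implicit Types (A B C E F : {set cell D}) (e : 'I_#|cell D|).

(** * Neighbouring cells and a single step of a slide *)

Definition after x y : bool :=
  (val y == ((val x).1, (val x).2.+1)) || (val y == ((val x).1.+1, (val x).2)).

Definition adjacent x y : bool := after x y || after y x.

(** With [F] the cells of label at least [k] and [V] the tabloid [U_k], this is [G k j]. *)
Definition level F V (j : nat) : {set cell D} := [set x in F | j <= V x].

Lemma after_irr x y : after x y -> y != x.
Proof.
by apply: contraTneq => ->; rewrite /after -!pair_eqE /pair_eq /=; lia.
Qed.

Lemma after_antisym x y : after x y -> ~~ after y x.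
Proof.
rewrite /after; case: (val x) (val y) => [a b] [a' b'] /=.
by rewrite -!pair_eqE /pair_eq /=; lia.
Qed.

Lemma adjacentC x y : adjacent x y = adjacent y x.
Proof. by rewrite /adjacent orbC. Qed.

Lemma locate_inj T c : injective T -> locate T (T c) = Some c.
Proof.
move=> Tinj; rewrite /locate; case: pickP => [x /eqP/Tinj -> //|/(_ c)].
by rewrite eqxx.
Qed.

Lemma entry_val T c : entry T (val c) = T c.
Proof. by rewrite /entry valK. Qed.

Lemma entry_lt T q e :
  entry T q < e -> exists2 d : cell D, val d = q & entry T q = T d.
Proof.
rewrite /entry; case: insubP => [d _ <- _|_]; first by exists d.
by move=> lt_e; have := ltn_ord e; lia.
Qed.

(** The position [q] holds the smaller of the two neighbouring entries; distinctness of entries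
    makes the inequality strict when [e] stops. *)
Lemma jdt_stepP V p e : injective V -> V p = e ->
  (jdt_step e V = V /\ forall z, after p z -> e < V z) \/
  (exists d, [/\ after p d, V d < e, jdt_step e V = exchange V p d
               & forall z, after p z -> V d <= V z]).
Proof.
move=> Vinj Vp; have locE : locate V e = Some p by rewrite -Vp locate_inj.
rewrite /jdt_step locE.
set right := (_, _.+1); set below := (_.+1, _).
set q := (if entry V right < entry V below then right else below).
have q_le z : after p z -> entry V q <= V z.
  rewrite -entry_val => /orP[]/eqP ->; rewrite /q; last by case: (ltnP (entry V right)) => // /ltnW.
    by case: (ltnP (entry V right)).
have [lt_e|ge_e] := ltnP (entry V q) e.
  right; have [d dE VdE] := entry_lt lt_e.
  exists d; split; rewrite -?VdE //.
    by rewrite /after dE /q; case: ifP; rewrite eqxx ?orbT.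
  by rewrite -dE (valK d).
left; split=> // z pz; rewrite ltn_neqAle (leq_trans ge_e (q_le _ pz)) andbT.
by rewrite -Vp val_eqE (inj_eq Vinj) eq_sym after_irr.
Qed.

Lemma exchangeL V p d : exchange V p d p = V d.
Proof. by rewrite ffunE tpermL. Qed.

Lemma exchangeR V p d : exchange V p d d = V p.
Proof. by rewrite ffunE tpermR. Qed.

Lemma exchangeD V p d x : x != p -> x != d -> exchange V p d x = V x.
Proof. by move=> xp xd; rewrite ffunE tpermD // eq_sym. Qed.

Lemma exchange_inj V p d : injective V -> injective (exchange V p d).
Proof. by move=> Vinj x y; rewrite !ffunE => /Vinj/perm_inj. Qed.

(** * The local rule: symmetry and determinacy *)

(* [A], [B], [C], [E] stand for [G k j], [G (k+1) j], [G k (j+1)] and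
   [G (k+1) (j+1)]; the boolean [b] tells whether [pi k = j]. *)
Definition local_rule (b : bool) A B C E : Prop :=
  if b then B = E /\ C = E else
  [\/ B = E /\ A = C, C = E /\ A = B
    | exists p d, [/\ p != d, p \notin E, d \notin E, A = p |: (d |: E)
        & B = d |: E /\ C = if adjacent p d then d |: E else p |: E]].

(** The first two alternatives trade places. In the third, adjacent cells give [B = C], so [p] and
    [d] keep their roles; otherwise they swap. *)
Lemma local_rule_sym b A B C E : local_rule b A B C E -> local_rule b A C B E.
Proof.
case: b => /= [[]//|[[? ?]|[? ?]|]].
- by constructor 2.
- by constructor 1.
case=> p [d [pd pE dE AE [BE]]].
case: ifP => adj CE; constructor 3.
  by exists p, d; rewrite adj.
exists d, p; split; rewrite 1?eq_sym //; first by rewrite AE setUCA.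
by rewrite adjacentC adj.
Qed.

(** In the third alternative [B] and [E] identify [d], then [A] identifies [p], and adjacency
    decides [C]. Mixing it with another alternative would let the addition of a new cell leave a set
    unchanged. *)
Lemma local_rule_uniq b A B C C' E :
  local_rule b A B C E -> local_rule b A B C' E -> C = C'.
Proof.
have neq1 x F : x \notin F -> x |: F = F -> False.
  by move=> xF eqF; move: xF; rewrite -eqF setU11.
have neq2 p d : p != d -> p \notin E -> p \notin d |: E.
  by move=> pd pE; rewrite in_setU1 negb_or pd.
case: b => /= [[_ ->] [_ ->] //|].
case=> [[BE AC]|[CE AB]|[p [d [pd pE dE AE [BE CE]]]]];
  case=> [[BE' AC']|[CE' AB']|[p' [d' [pd' pE' dE' AE' [BE' CE']]]]]; subst=> //.
- by case: (neq1 d' E).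
- by case: (neq1 p' (d' |: E)) => //; exact: neq2.
- by case: (neq1 d E).
- by case: (neq1 p (d |: E)) => //; exact: neq2.
have dd : d = d'.
  by have := setU11 d E; rewrite BE' !inE (negPf dE) orbF => /eqP.
subst d'; have pp : p = p'.
  have := setU11 p (d |: E).
  by rewrite AE' !inE (negPf pE) (negPf pd) !orbF => /eqP.
by subst p'.
Qed.

(** * The effect of one slide on the levels *)

(** Here [p] lies in both [A] and [C]. If [j] sits at a cell [d] of [F], the third alternative holds
    in its non-adjacent branch; otherwise the levels do not change. *)
Lemma local_rule_off F V p A C (j : nat) :
  injective V -> (forall d, d \in F -> V d = j :> nat -> ~~ adjacent p d) ->
  p \in F -> V p != j :> nat ->
  A = p |: level (F :\ p) V j -> C = p |: level (F :\ p) V j.+1 ->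
  local_rule false A (level (F :\ p) V j) C (level (F :\ p) V j.+1).
Proof.
move=> Vinj nadj pF Vpj -> ->.
have [/existsP[d /andP[dF /eqP Vd]]|no_d] :=
  boolP [exists d, (d \in F) && (V d == j :> nat)].
  have pd : p != d by apply: contra_neq Vpj => ->.
  have lvl : level (F :\ p) V j = d |: level (F :\ p) V j.+1.
    apply/setP=> x; rewrite !inE; have [->|xd] := eqVneq x d.
      by rewrite eq_sym pd dF Vd leqnn.
    congr (_ && _); rewrite [in LHS]leq_eqVlt -Vd val_eqE (inj_eq Vinj).
    by rewrite eq_sym (negPf xd).
  constructor 3; exists p, d; split=> //.
  - by rewrite !inE eqxx.
  - by rewrite !inE Vd ltnn !andbF.
  - by rewrite -lvl.
  - by rewrite (negPf (nadj d dF Vd)).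
constructor 1; have -> : level (F :\ p) V j = level (F :\ p) V j.+1; last by [].
apply/setP=> x; rewrite !inE; case xF: (x \in F); rewrite ?andbF //=.
congr (_ && _); rewrite leq_eqVlt eq_sym.
by move/existsPn: no_d => /(_ x); rewrite xF /= => /negPf ->.
Qed.

Lemma level_hole F V p (j : nat) : p \in F ->
  level F V j = if j <= V p then p |: level (F :\ p) V j
                else level (F :\ p) V j.
Proof.
move=> pF; case: ifP => Vp; apply/setP=> x; rewrite !inE;
  by have [->|] := eqVneq x p; rewrite ?pF ?Vp.
Qed.

(* The cell [p] is the current position of [e], and all entries below [t] have
   already reached their final position. *)
Lemma slide F e (N : nat) V p (t : nat) :
    injective V -> p \in F -> V p = e -> t <= e ->
    (forall x y, x \in F -> after x y -> y \in F) ->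
    (forall z, after p z -> t <= V z) ->
    (forall x, x \in F -> after x p -> V x < t) ->
    (forall x y, x \in F -> x != p -> after x y -> y != p -> V x < V y) ->
    let W := iter N (jdt_step e) V in
    jdt_step e W = W ->
  [/\ forall j, t <= j ->
        local_rule (j == e) (level F W j) (level (F :\ p) V j)
          (level F W j.+1) (level (F :\ p) V j.+1),
      forall x (j : nat), j <= t -> (j <= W x) = (j <= V x),
      forall x, x \notin F -> W x = V x
    & forall x y, x \in F -> after x y -> W x < W y].
Proof.
move=> + + + + Fup.
elim: N V p t => [|N IH] V p t Vinj pF Vp te aft bef srt W Wfix.
  (* With no step left, [W] is [V]; an exchange would lower the entry at [p], against [Wfix]. *)
  have [[_ gt_e]|[d [pd lt_e stepE _]]] := jdt_stepP Vinj Vp; last first.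
    move: Wfix; rewrite /W /= stepE => fixV.
    by move: lt_e; rewrite -(exchangeL V p d) fixV Vp ltnn.
  rewrite /W {W Wfix} /=; split=> //.
  - move=> j tj; rewrite !(level_hole V _ pF) Vp; case: ltngtP => /= [lt_j|gt_j|->].
    + apply: local_rule_off; rewrite ?Vp //; last by rewrite gtn_eqF.
      move=> d dF Vd; apply/negP => /orP[/gt_e|/(bef _ dF)]; rewrite Vd ltnNge.
        by rewrite ltnW.
      by rewrite tj.
    + by constructor 2.
    + split=> //; apply/setP=> x; rewrite !inE; case: eqVneq => //= xp.
      by congr (_ && _); rewrite leq_eqVlt -Vp val_eqE (inj_eq Vinj) eq_sym (negPf xp).
  - move=> x y xF xy; have [xp|xp] := eqVneq x p.
      by subst x; rewrite Vp gt_e.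
    have [yp|yp] := eqVneq y p; last exact: srt.
    by subst y; rewrite Vp (leq_trans _ te) // bef.
have [[stepE _]|[d [pd lt_e stepE min_d]]] := jdt_stepP Vinj Vp.
  have WE : W = iter N (jdt_step e) V by rewrite /W iterSr stepE.
  by rewrite WE; apply: IH => //; rewrite -WE.
have WE : W = iter N (jdt_step e) (exchange V p d) by rewrite /W iterSr stepE.
have dp := after_irr pd; have dF := Fup _ _ pF pd.
have td := aft _ pd.
(* After the exchange [e] sits at [d], and the entry [V d], now at [p], will not move again; hence
   the new bound [(V d).+1]. *)
have [||||z dz|x xF xd|x y xF xd xy yd||loc low out Wsrt] := IH (exchange V p d) d (V d).+1.
- exact: exchange_inj.
- exact: dF.
- by rewrite exchangeR.
- exact: lt_e.
- have zd := after_irr dz.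
  have zp : z != p by apply: contraTneq dz => ->; exact: after_antisym.
  by rewrite exchangeD // srt.
- have [->|xp] := eqVneq x p; first by rewrite exchangeL.
  have xd' : x != d by rewrite eq_sym (after_irr xd).
  by rewrite exchangeD // ltnW // ltnS srt.
- have [xp|xp] := eqVneq x p.
    subst x; have yp := after_irr xy.
    rewrite exchangeL exchangeD // ltn_neqAle min_d // andbT.
    by rewrite val_eqE (inj_eq Vinj) eq_sym.
  rewrite (exchangeD V xp xd); have [yp|yp] := eqVneq y p.
    by subst y; rewrite exchangeL (leq_trans _ td) // bef.
  by rewrite exchangeD // srt.
- by rewrite -WE.
rewrite -WE in loc low out Wsrt.
have exch x (j : nat) : j <= V d -> (j <= exchange V p d x) = (j <= V x).
  move=> jd; have [->|xp] := eqVneq x p; first by rewrite exchangeL Vp; lia.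
  have [->|xd] := eqVneq x d; first by rewrite exchangeR Vp; lia.
  by rewrite exchangeD.
have WV x (j : nat) : j <= V d -> (j <= W x) = (j <= V x).
  by move=> jd; rewrite low ?exch // ltnW.
have lvlW (j : nat) : j <= V d -> level F W j = p |: level (F :\ p) V j.
  move=> jd; have -> : level F W j = level F V j.
    by apply/setP=> x; rewrite !inE WV.
  by rewrite (level_hole V _ pF) Vp ifT //; lia.
have lvlV (j : nat) : V d < j ->
    level (F :\ d) (exchange V p d) j = level (F :\ p) V j.
  move=> dj; apply/setP=> x; rewrite !inE; have [->|xp] := eqVneq x p.
    by rewrite exchangeL leqNgt dj !andbF.
  have [->|xd] := eqVneq x d; last by rewrite exchangeD.
  by rewrite /= leqNgt dj !andbF.
split=> //.
(* Below [V d], the minimum among the cells after [p], no neighbour of [p] in [F] holds [j]; above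
   it the square is that of the remaining slide; at [V d] the cells [p] and [d] form an adjacent
   pair. *)
- move=> j tj; have [lt_j|gt_j|jE] := ltngtP j (V d).
  + rewrite (ltn_eqF (ltn_trans lt_j lt_e)).
    apply: local_rule_off; rewrite ?Vp ?lvlW ?(ltnW lt_j) //; last by lia.
    move=> x xF Vx; apply/negP => /orP[/min_d|/(bef _ xF)]; rewrite Vx.
      by rewrite leqNgt lt_j.
    by rewrite ltnNge tj.
  + by rewrite -!lvlV ?(leqW gt_j) //; apply: loc.
  + have dE : d \notin level (F :\ p) V j.+1 by rewrite !inE jE ltnn !andbF.
    have lvlVj : level (F :\ p) V j = d |: level (F :\ p) V j.+1.
      apply/setP=> x; rewrite !inE; have [->|xd] := eqVneq x d.
        by rewrite dp dF jE leqnn.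
      congr (_ && _); rewrite [in LHS]leq_eqVlt jE val_eqE (inj_eq Vinj).
      by rewrite eq_sym (negPf xd).
    rewrite [j == e]ltn_eqF ?jE // -jE.
    constructor 3; exists p, d; split=> //; rewrite 1?eq_sym //.
    * by rewrite !inE eqxx.
    * by rewrite lvlW ?jE // -jE lvlVj.
    split=> //; rewrite /adjacent pd /=.
    (* Now [d] holds [e > j] while [p] holds [j] and drops out, so [C = d |: E]. *)
    have -> : level F W j.+1 = level F (exchange V p d) j.+1.
      by apply/setP=> x; rewrite !inE low // jE.
    by rewrite (level_hole _ _ dF) exchangeR Vp jE lt_e lvlV.
- by move=> x j jt; rewrite WV // (leq_trans jt).
- by move=> x xF; rewrite out // exchangeD //; apply: contraNneq xF => ->.
Qed.

Definition increasing T : Prop := forall x y, after x y -> T x < T y.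

Lemma standard_increasing T : is_standard T -> increasing T.
Proof.
case=> _ row col x y /orP[]/eqP xy.
  by apply: row; rewrite xy /=.
by apply: col; rewrite xy /=.
Qed.

(** * Growth arrays *)

(** Corners are indexed from 0 to [#|cell D|], unit squares by ['I_#|cell D|]; the empty borders
    reflect that no label or entry reaches [#|cell D|]. *)
Definition growth (pi : {perm 'I_#|cell D|}) (G : nat -> nat -> {set cell D}) :=
  [/\ forall k, G k #|cell D| = set0, forall j, G #|cell D| j = set0
    & forall k j : 'I_#|cell D|,
        local_rule (j == pi k) (G k j) (G k.+1 j) (G k j.+1) (G k.+1 j.+1)].

Lemma growth_transpose pi G : growth pi G -> growth (pi^-1)%g (fun k j => G j k).
Proof.
case=> col row loc; split=> // k j; apply: local_rule_sym.
by rewrite eq_sym (canF_eq (permKV pi)); exact: loc.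
Qed.

(** Induction downwards on [k] and upwards on [j]: [local_rule_uniq] yields the corner [C] from the
    three others. *)
Lemma growth_uniq pi G H : growth pi G -> growth pi H ->
  (forall k, G k 0 = H k 0) ->
  forall k j, k <= #|cell D| -> j <= #|cell D| -> G k j = H k j.
Proof.
case=> [_ Grow Gloc] [_ Hrow Hloc] GH0 k j /subKn <-.
elim: (#|cell D| - k) j => [|i IH] j jn; first by rewrite subn0 Grow Hrow.
(* Once [i] reaches [#|cell D|], truncated subtraction makes both indices 0. *)
have [lt_i|ge_i] := ltnP i #|cell D|; last first.
  by have := IH j jn; rewrite (eqP ge_i) (eqP (leqW ge_i)).
have kS : (#|cell D| - i.+1).+1 = #|cell D| - i by rewrite subnSK.
have kn : #|cell D| - i.+1 < #|cell D| by lia.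
elim: j jn => [//|j IHj] jn.
have := Gloc (Ordinal kn) (Ordinal jn); have := Hloc (Ordinal kn) (Ordinal jn).
rewrite /= kS -!IH ?(ltnW jn) // -IHj ?(ltnW jn) // => loc' loc.
exact: local_rule_uniq loc loc'.
Qed.

(** * Modified jeu de taquin as a growth array *)

Lemma filling_eq_level T U :
  (forall j, j <= #|cell D| -> level setT T j = level setT U j) -> T = U.
Proof.
move=> TU; apply/ffunP=> x; apply/val_inj/eqP; rewrite eqn_leq.
have /setP/(_ x) := TU (T x) (ltnW (ltn_ord _)).
have /setP/(_ x) := TU (U x) (ltnW (ltn_ord _)).
by rewrite !inE !leqnn /= => -> <-.
Qed.

(** Since [foldr] treats the last labels first, dropping the first [k] labels leaves the slides with
    labels at least [k]: this is [U_k]. *)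
Definition partial_MJ S T (k : nat) : filling D :=
  foldr (fun k U => if locate S k is Some c then jdt (T c) U else U)
        T (drop k (enum 'I_#|cell D|)).

Lemma partial_MJ_step P c (pi : {perm 'I_#|cell D|}) : injective P ->
  partial_MJ P (relabel P pi) (P c) =
  jdt (pi (P c)) (partial_MJ P (relabel P pi) (P c).+1).
Proof.
move=> Pinj; rewrite /partial_MJ (drop_nth (P c)) ?size_enum_ord //=.
by rewrite nth_ord_enum locate_inj // ffunE.
Qed.

Lemma jdt_inj V e : injective V -> injective (jdt e V).
Proof.
move=> Vinj; suff iter_inj k : is_tabloid (iter k (jdt_step e) V).
  exact/injectiveP/iter_inj.
elim: k => [|k IH] /=; first exact/injectiveP.
exact: jdt_step_tabloid.
Qed.

Lemma MJ_growth P (pi : {perm 'I_#|cell D|}) : injective P -> increasing P ->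
  exists G, [/\ growth pi G, forall k, G k 0 = level setT P k
    & forall j, G 0 j = level setT (MJ P (relabel P pi)) j].
Proof.
move=> Pinj Pinc; pose T := relabel P pi; pose U := partial_MJ P T.
pose F k := level setT P k.
have P_onto (k : 'I_#|cell D|) : exists c, P c = k.
  have /codomP[c ->] : k \in codom P; last by exists c.
  by rewrite inj_card_onto ?card_ord.
have Tinj : injective T by move=> x y; rewrite !ffunE => /perm_inj/Pinj.
have Un : U #|cell D| = T.
  by rewrite /U /partial_MJ drop_oversize // size_enum_ord.
have Fup k x y : x \in F k -> after x y -> y \in F k.
  by rewrite !inE /= => kx /Pinc /ltnW; exact: leq_trans.
have FS c : F (P c).+1 = F (P c) :\ c.
  apply/setP=> x; rewrite !inE /= ltn_neqAle val_eqE (inj_eq Pinj).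
  by rewrite eq_sym.
(* Cells outside [F k] are still untouched, so the cell treated next holds its initial entry; the
   order on [F k] feeds [slide]. The equation [k = k'] makes the last clause vacuous at
   [k = #|cell D|]. *)
have main k : k <= #|cell D| ->
  [/\ injective (U k), forall x, x \notin F k -> U k x = T x,
      forall x y, x \in F k -> after x y -> U k x < U k y
    & forall k' : 'I_#|cell D|, k = k' -> forall j : nat,
        local_rule (j == pi k') (level (F k) (U k) j)
         (level (F k.+1) (U k.+1) j)
         (level (F k) (U k) j.+1) (level (F k.+1) (U k.+1) j.+1)].
  move=> /subKn <-; elim: (#|cell D| - k) => [|i IH].
    rewrite subn0 Un; split=> // [x y|k' kE]; first by rewrite !inE leqNgt ltn_ord.
    by have := ltn_ord k'; rewrite -kE ltnn.
  have [lt_i|ge_i] := ltnP i #|cell D|; last first.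
    by move: IH; rewrite (eqP ge_i) (eqP (leqW ge_i)).
  have kn : #|cell D| - i.+1 < #|cell D| by lia.
  have [c Pc] := P_onto (Ordinal kn).
  have kE : #|cell D| - i.+1 = P c by rewrite Pc.
  move: IH; rewrite -(subnSK lt_i) kE => -[Vinj Vout Vsrt _].
  have cF : c \in F (P c) by rewrite !inE leqnn.
  have Vc : U (P c).+1 c = pi (P c) by rewrite Vout ?ffunE // !inE ltnn.
  have srt x y : x \in F (P c) -> x != c -> after x y -> U (P c).+1 x < U (P c).+1 y.
    by move=> xF xc; apply: Vsrt; rewrite FS in_setD1 xc.
  have UE : U (P c) = jdt (pi (P c)) (U (P c).+1) by exact: partial_MJ_step.
  (* At the start no entry is known to be final, hence [t = 0]; no cell of [F (P c)] precedes [c],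
     which carries its least label. *)
  have [||||loc _ out Wsrt] := @slide (F (P c)) (pi (P c)) #|cell D| (U (P c).+1) c 0
    Vinj cF Vc (leq0n _) (Fup _).
  - by [].
  - by move=> x; rewrite !inE /= => le_c /Pinc; rewrite ltnNge le_c.
  - by move=> x y xF xc xy _; exact: srt.
  - exact/jdt_stops/injectiveP.
  rewrite UE; split=> //.
  - exact: jdt_inj.
  - by move=> x xF; rewrite [LHS]out // Vout // FS in_setD1 (negPf xF) andbF.
  - by move=> k' /val_inj <- j; rewrite FS; exact: loc.
exists (fun k j => level (F k) (U k) j); split.
- split.
  + by move=> k; apply/setP=> x; rewrite !inE [_ <= U k x]leqNgt ltn_ord andbF.
  + by move=> j; apply/setP=> x; rewrite !inE leqNgt ltn_ord.
  + by move=> k j; have [_ _ _ /(_ k erefl j)] := main k (ltnW (ltn_ord k)).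
- by move=> k; apply/setP=> x; rewrite !inE andbT.
- by move=> j; apply/setP=> x; rewrite !inE /= /U /partial_MJ drop0.
Qed.

(** The array of [Q] and the transposed array of [P] share the border given by [Q], hence coincide;
    their other borders then identify the result of the second run with [P]. *)
Lemma MJ_inverse P Q (pi : {perm 'I_#|cell D|}) :
  is_standard P -> is_standard Q ->
  MJ P (relabel P pi) = Q -> MJ Q (relabel Q (pi^-1)%g) = P.
Proof.
move=> stdP stdQ PQ.
have [/injectiveP Pinj _ _] := stdP; have [/injectiveP Qinj _ _] := stdQ.
have [G [Ggr G0 Gend]] := MJ_growth pi Pinj (standard_increasing stdP).
have [H [Hgr H0 Hend]] := MJ_growth pi^-1 Qinj (standard_increasing stdQ).
apply: filling_eq_level => j jn; rewrite -Hend -G0.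
apply: (growth_uniq Hgr (growth_transpose Ggr)) => // k.
by rewrite H0 Gend PQ.
Qed.

End Growth.

Theorem theorem1 (shifted : bool) (r : nat) (la mu : r.-tuple nat)
    (shape : is_skew_shape shifted la mu)
    (P Q : filling (skew_diagram shifted la mu))
    (stdP : is_standard P) (stdQ : is_standard Q)
    (pi : {perm 'I_#|cell (skew_diagram shifted la mu)|}) :
  MJ P (relabel P pi) = Q <-> MJ Q (relabel Q (pi^-1)%g) = P.
Proof.
split; first exact: MJ_inverse.
by move=> QP; rewrite -[pi]invgK; exact: MJ_inverse.
Qed.
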